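(* Let $\{P_n\}_{n\in\mathbb{N}}$ be a $3$-fold symmetric Hahn-classical $2$-orthogonal polynomial sequence. Then each of the three cubic components $\{P_n^{[k]}(x)\}_{n\in\mathbb{N}}$, $k\in\{0,1,2\}$, given by $P_{3n+k}(x)=x^kP_n^{[k]}(x^3)$ for all $n\in\mathbb{N}$, is Hahn-classical.
   Context: $\mathbb{N}=\{0,1,2,\dots\}$. Polynomial sequences $\{P_n\}_{n\in\mathbb{N}}$ are monic with $\deg P_n=n$. A polynomial sequence $\{P_n\}$ is $2$-orthogonal with respect to a pair of measures $(\mu_0,\mu_1)$ (or, more generally, a pair of linear functionals $(u_0,u_1)$ on polynomials, with $\langle u_j,f\rangle$ in place of $\int f\,d\mu_j$) if for all $k,n\in\mathbb{N}$: $\int x^kP_n\,d\mu_0=0$ if $n\ge2k+1$ and $\ne0$ if $n=2k$; and $\int x^kP_n\,d\mu_1=0$ if $n\ge2k+2$ and $\neq0$ if $n=2k+1$. Equivalently, $\{P_n\}$ satisfies a recurrence $P_{n+1}(x)=(x-\beta_n)P_n(x)-\alpha_nP_{n-1}(x)-\gamma_{n-1}P_{n-2}(x)$ with $\gamma_n\ne0$ for all $n\ge1$ and $P_{-2}=P_{-1}=0$, $P_0=1$. A $2$-orthogonal polynomial sequence $\{P_n\}$ is Hahn-classical if the sequence of derivatives $\left\{\frac{1}{n+1}P_{n+1}'(x)\right\}_{n\in\mathbb{N}}$ is also $2$-orthogonal. A polynomial sequence $\{P_n\}$ is $3$-fold symmetric if for all $n\in\mathbb{N}$, $P_n(e^{2\pi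 i/3}x)=e^{2n\pi i/3}P_n(x)$ and $P_n(e^{4\pi i/3}x)=e^{4n\pi i/3}P_n(x)$; this is equivalent to the existence of three polynomial sequences $\{P_n^{[k]}\}_{n\in\mathbb{N}}$, $k\in\{0,1,2\}$ (the cubic components), with $P_{3n+k}(x)=x^kP_n^{[k]}(x^3)$ for all $n$. *)

(* Defs.v *)
From mathcomp Require Import all_boot all_order all_algebra.
From mathcomp Require Import all_classical all_reals all_analysis.
From mathcomp.real_closed Require Export complex.
From mathcomp Require Import ring lra.

Set Implicit Arguments.
Unset Strict Implicit.
Unset Printing Implicit Defensive.

Import Order.TTheory GRing.Theory Num.Theory.

Local Open Scope ring_scope.
Local Open Scope complex_scope.

Section Definitions.
Variable R : realType.
Local Notation C := R[i].
Implicit Types P Q : nat -> {poly C}.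

Definition expi (t : R) : C := cos t +i* sin t.

Definition polynomial_sequence P :=
  forall n, P n \is monic /\ size (P n) = n.+1.

(* Arbitrary C-linear functionals replace the measures: u_j f stands for the
   integral of f against mu_j. *)
Definition two_orthogonal_wrt (u0 u1 : {scalar {poly C}}) P :=
  forall k n : nat,
    [/\ (2 * k + 1 <= n)%N -> u0 ('X^k * P n) = 0,
        n = (2 * k)%N -> u0 ('X^k * P n) != 0,
        (2 * k + 2 <= n)%N -> u1 ('X^k * P n) = 0
      & n = (2 * k + 1)%N -> u1 ('X^k * P n) != 0].

Definition two_orthogonal P :=
  polynomial_sequence P /\ exists u0 u1, two_orthogonal_wrt u0 u1 P.

Definition monic_derivatives P : nat -> {poly C} :=
  fun n => n.+1%:R^-1 *: (P n.+1)^`().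

Definition Hahn_classical P :=
  two_orthogonal P /\ two_orthogonal (monic_derivatives P).

(* [p \Po (a *: 'X)] is p(a x). *)
Definition threefold_symmetric P :=
  forall n : nat,
    P n \Po (expi (2 * pi / 3) *: 'X) = expi (2 * n%:R * pi / 3) *: P n /\
    P n \Po (expi (4 * pi / 3) *: 'X) = expi (4 * n%:R * pi / 3) *: P n.

Definition cubic_component P (k : 'I_3) Q :=
  forall n : nat, P (3 * n + k)%N = 'X^k * (Q n \Po 'X^3).

Lemma expi0 : expi 0 = 1.
Proof. by rewrite /expi cos0 sin0. Qed.

Lemma expiD (s t : R) : expi (s + t) = expi s * expi t.
Proof.
rewrite /expi cosD sinD; apply/eqP; rewrite eq_complex /=.
by rewrite eqxx /= addrC [sin s * _]mulrC.
Qed.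

Lemma expiM (n : nat) (t : R) : expi (n%:R * t) = expi t ^+ n.
Proof.
elim: n => [|n IHn]; first by rewrite mul0r expi0 expr0.
by rewrite -[n.+1]add1n natrD mulrDl mul1r expiD IHn exprD expr1.
Qed.

Lemma expi_prim_root : 3.-primitive_root (expi (2 * pi / 3)).
Proof.
have w3 : 3.-unity_root (expi (2 * pi / 3)).
  apply/unity_rootP; rewrite -expiM.
  have -> : 3%:R * (2 * pi / 3) = pi *+ 2 :> R by rewrite mulr2n; field.
  by rewrite /expi cos2pi sin2pi.
have [m prim_m dvd_m] := prim_order_exists (isT : (0 < 3)%N) (unity_rootP w3).
suff m1 : m != 1%N.
  by case: m prim_m dvd_m m1 => [|[|[|[|m]]]] // _ /dvdn_leq /(_ isT).
apply: contra_eq_neq (prim_expr_order prim_m) => ->; rewrite expr1 eq_complex /=.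
rewrite negb_and orbC gt_eqF // sin_gt0_pi //.
by have pi0 := pi_gt0 R; apply/andP; split; lra.
Qed.

Lemma threefold_symmetric_coef P : threefold_symmetric P ->
  forall n i, (P n)`_i != 0 -> i = n %[mod 3].
Proof.
move=> symP n i Pi; have [/polyP /(_ i) + _] := symP n; rewrite coefZ.
have -> : 2 * n%:R * pi / 3 = n%:R * (2 * pi / 3) :> R by field.
rewrite expiM comp_polyE coef_sum => eqi.
apply/eqP; rewrite -(eq_prim_root_expr expi_prim_root); apply/eqP.
apply: (mulIf Pi); rewrite -eqi.
have lti : (i < size (P n))%N.
  by rewrite ltnNge; apply: contraNN Pi => /(nth_default 0) ->.
rewrite (bigD1 (Ordinal lti)) //= big1 ?addr0 => [|j /negP nij].
  by rewrite exprZn !coefZ coefXn eqxx mulr1 mulrC.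
rewrite exprZn !coefZ coefXn; case: eqP => [eqij|_]; last by rewrite !mulr0.
by case: nij; apply/eqP/val_inj.
Qed.

(* [cubic_component] is a defining relation rather than a function; this and
   the next lemma show that it determines exactly one sequence. *)
Lemma cubic_component_exists P (k : 'I_3) :
  threefold_symmetric P -> exists Q, cubic_component P k Q.
Proof.
move=> symP; exists (fun n => \poly_(i < size (P (3 * n + k)%N))
                               (P (3 * n + k)%N)`_(3 * i + k)).
move=> n; apply/polyP => i; rewrite coefXnM coef_comp_poly_Xn // coef_poly.
have := threefold_symmetric_coef symP (n := 3 * n + k) (i := i).
have := ltn_ord k; set p := P _ => ltk3 modi.
have pi0 : (i %% 3 != k)%N -> p`_i = 0.
  move=> nik; apply/eqP; apply: contraNT nik => /modi ->.
  by rewrite mulnC modnMDl modn_small.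
case: ltnP => [ltik|leki].
  by rewrite pi0 // modn_small ?(ltn_trans ltik) // ltn_eqF.
case: ifP => [dvd3|ndvd3]; last first.
  by rewrite pi0 // -(modn_small ltk3) eqn_mod_dvd // ndvd3.
have -> : (3 * ((i - k) %/ 3) + k)%N = i by rewrite mulnC divnK // subnK.
case: ltnP => // le_p; rewrite nth_default // (leq_trans le_p) //.
by rewrite (leq_trans (leq_div _ _)) // leq_subr.
Qed.

Lemma cubic_component_unique P (k : 'I_3) Q Q' :
  cubic_component P k Q -> cubic_component P k Q' -> Q = Q'.
Proof.
move=> PQ PQ'; apply/funext => n; apply/eqP; rewrite -subr_eq0.
rewrite -(@comp_poly_eq0 _ _ 'X^3) ?size_polyXn // comp_polyB subr_eq0.
apply/eqP/(@mulfI _ 'X^k); first by rewrite monic_neq0 ?monicXn.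
by rewrite -PQ -PQ'.
Qed.

End Definitions.

(* Main.v *)
Require Import Defs.
From HB Require Import structures.
From mathcomp Require Import all_boot all_order all_algebra.
From mathcomp Require Import all_classical all_reals all_analysis.
From mathcomp Require Import ring zify.

Local Open Scope ring_scope.
Local Open Scope complex_scope.

Import GRing.Theory Num.Theory.

(** Write Q_n = P_(n+1)' / (n+1), and let (u0, u1) and (v0, v1) be functionals
for which P and Q are 2-orthogonal.

A 2-orthogonal sequence has 2-orthogonal cubic components because the index
arithmetic works out: the pairing u0 (X^t P_N) dies exactly after N = 2t and
u1 (X^t P_N) exactly after N = 2t+1. In the subsequence N = 3n+k, with
t = e + 3j, one finds for each k a shift e of u0 and a shift e' of u1 such that
the last nonzero pairings occur at n = 2j and n = 2j+1, in one order or the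
other. This is [two_orthogonal_thinning].

The derivatives of a component B, given by P_(3n+k) = X^k B_n(X^3), are not
components of Q in general. The chain rule gives instead
  3 X^(k+t+3) B_n'(X^3) = (X^(t+1) p)' - (k+t+1) X^t p,   p = P_(3n+k),
so it is enough to know where v0 and v1 of the right-hand side (the twisted
derivative of p) vanish and where they do not; the result then follows by the
same index arithmetic. Threefold symmetry makes each functional live on a
single residue class of degrees modulo 3, once u1 and v1 are normalised to
vanish at 1, and this reduces the matrix Pearson equation of a Hahn-classical
sequence to four scalar relations
  v0 (p') = l u1 p,        v0 p = a u0 p + b u1 (X p),
  v1 (p') = h u0 (X p),    v1 p = c u1 p + d u0 (X^2 p).
With s = k+t they turn the value of v0 at a twisted derivative into
  (l - (s+1) b) u1 (X^(t+1) p) - (s+1) a u0 (X^t p),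
and similarly for v1 with the factor h - (s+1) d. Orthogonality of P gives
the vanishing. The value at the last index is nonzero because l - (s+1) b is:
for k = 0 the twisted derivative is X^(t+1) p', whose last nonzero value under
v0 is guaranteed by the orthogonality of Q, and as t varies this covers all
the factors that occur for any k. *)

Section CubicComponents.

Set Implicit Arguments.
Unset Strict Implicit.

Variable R : realType.
Local Notation C := R[i].
Implicit Types (P Q : nat -> {poly C}) (L M : {poly C} -> C).

(** * Linear functionals and graded polynomials *)

Lemma scalar_functional L :
  scalar L -> exists u : {scalar {poly C}}, u =1 L.
Proof.
move=> linL; pose lin := GRing.isLinear.Build _ _ _ *%R L linL.
by exists (HB.pack_for {scalar {poly C}} L lin).
Qed.

(** A polynomial sequence is a basis: subtracting a multiple of [P n] lowers the
degree. *)
Lemma functional_eq P L M : polynomial_sequence P -> scalar L -> scalar M ->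
  (forall n, L (P n) = M (P n)) -> L =1 M.
Proof.
move=> psP /scalar_functional[u /funext<-] /scalar_functional[v /funext<-] uv p.
have [n] := ubnP (size p).
elim: n p => // n IHn p; rewrite ltnS => szp.
have [monP szP] := psP n.-1.
case: n IHn szp monP szP => [_|n IHn szp /= monP szP].
  by rewrite leqn0 size_poly_eq0 => /eqP->; rewrite !linear0.
pose r : {poly C} := p - p`_n *: P n.
suff /IHn : (size r < n.+1)%N by rewrite !linearB !linearZ /= uv => /addIr.
rewrite ltnS; apply/leq_sizeP => j; rewrite leq_eqVlt.
move=> /predU1P[<-|ltnj]; last first.
  rewrite coefB coefZ !(@nth_default _ 0 _ j) ?szP ?(leq_trans szp) //.
  by rewrite mulr0 subr0.
move/monicP: monP; rewrite lead_coefE szP /= => Pn.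
by rewrite coefB coefZ Pn mulr1 subrr.
Qed.

Lemma P0_eq1 P : polynomial_sequence P -> P 0 = 1.
Proof.
move=> /(_ 0)[/monicP + szP]; rewrite lead_coefE szP /= => P00.
by rewrite [P 0]size1_polyC ?szP // P00.
Qed.

(** Threefold symmetry of [P] amounts to [graded n (P n)]: the degrees of the
monomials of [P n] are all congruent to [n] modulo 3. *)
Definition graded (n : nat) (p : {poly C}) :=
  forall i, p`_i != 0 -> i = n %[mod 3].

(** The vanishing of [L] on the [P n] with [n] outside one residue class passes
to the monomials, because [P n] is ['X^n] plus lower monomials of the same
class, and from them to all graded polynomials of the other classes. *)
Lemma graded_functional0 P (L : {scalar {poly C}}) r :
  polynomial_sequence P -> (forall n, graded n (P n)) ->
  (forall n, n != r %[mod 3] -> L (P n) = 0) ->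
  forall n p, graded n p -> n != r %[mod 3] -> L p = 0.
Proof.
move=> psP grP LP.
have LX n : n != r %[mod 3] -> L 'X^n = 0.
  elim/ltn_ind: n => n IHn nr; have := LP _ nr.
  have [/monicP + szP] := psP n; rewrite lead_coefE szP /= => Pn.
  rewrite -[P n]coefK poly_def szP big_ord_recr /= linearD Pn scale1r /=.
  rewrite linear_sum big1 ?add0r //= => i _; rewrite linearZ /=.
  have [->|/grP Pi] := eqVneq (P n)`_i 0; first by rewrite mul0r.
  by rewrite IHn ?mulr0 // Pi.
move=> n p grp nr; rewrite -[p]coefK poly_def linear_sum big1 //= => i _.
rewrite linearZ /=; have [->|/grp pi] := eqVneq p`_i 0; first by rewrite mul0r.
by rewrite LX ?mulr0 // pi.
Qed.

Lemma graded_mulXn j n p : graded n p -> graded (j + n) ('X^j * p).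
Proof.
move=> grp i; rewrite coefXnM; case: ltnP => [_|leji]; first by rewrite eqxx.
by move=> /grp eqn; rewrite -(subnKC leji) -modnDmr eqn modnDmr.
Qed.

Lemma graded_deriv n p : graded n.+1 p -> graded n p^`().
Proof.
move=> grp i; rewrite coef_deriv => nz.
have /grp eqn : p`_i.+1 != 0 by apply: contraNneq nz => ->; rewrite mul0rn.
lia.
Qed.

(** * Derivatives and cubic components as polynomial sequences *)

Lemma polynomial_sequence_derivatives P :
  polynomial_sequence P -> polynomial_sequence (monic_derivatives P).
Proof.
move=> psP n; have [/monicP + szP] := psP n.+1.
rewrite lead_coefE szP /= => Pn; pose p := monic_derivatives P n.
have pn : p`_n = 1.
  by rewrite coefZ coef_deriv Pn mulVf // pnatr_eq0.
have szp : size p = n.+1.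
  apply/eqP; rewrite eqn_leq; apply/andP; split.
    rewrite (leq_trans (size_scale_leq _ _)) // -ltnS -szP lt_size_deriv //.
    by rewrite -size_poly_eq0 szP.
  by rewrite ltnNge; apply: contraPN pn => /(nth_default 0) ->;
    apply/eqP; rewrite eq_sym oner_eq0.
by split=> //; apply/monicP; rewrite lead_coefE szp.
Qed.

Lemma polynomial_sequence_component P (k : 'I_3) Q :
  polynomial_sequence P -> cubic_component P k Q -> polynomial_sequence Q.
Proof.
move=> psP PQ n; have [monP szP] := psP (3 * n + k)%N.
have X31 : (1 < size ('X^3 : {poly C}))%N by rewrite size_polyXn.
have lcQ : lead_coef (Q n) = 1.
  move: monP; rewrite monicE PQ lead_coefM lead_coef_comp // !lead_coefXn.
  by rewrite expr1n mulr1 mul1r => /eqP.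
have nzQ : Q n != 0 by rewrite -lead_coef_eq0 lcQ oner_eq0.
have nzQ3 : Q n \Po 'X^3 != 0.
  apply: contraTneq monP => Q0.
  by rewrite PQ Q0 mulr0 monicE lead_coef0 eq_sym oner_eq0.
split; first by apply/monicP.
move: szP; rewrite PQ size_mul ?expf_neq0 ?polyX_eq0 // size_polyXn.
have := size_comp_poly (Q n) ('X^3); rewrite size_polyXn /=.
have : (0 < size (Q n))%N by rewrite size_poly_gt0.
have : (0 < size (Q n \Po 'X^3))%N by rewrite size_poly_gt0.
move: (size (Q n)) (size (Q n \Po _)) (nat_of_ord k) => a b c; lia.
Qed.

Lemma derivS_monic_derivatives P n :
  (P n.+1)^`() = n.+1%:R *: monic_derivatives P n.
Proof. by rewrite scalerA divff ?scale1r // pnatr_eq0. Qed.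

(** * Two-orthogonality in terms of last nonzero pairings *)

(** Of a sequence of pairings only the last nonzero term matters for
two-orthogonality; the earlier ones are unconstrained. *)
Definition ends_at (F : nat -> C) (m : nat) :=
  (forall n, (m < n)%N -> F n = 0) /\ F m != 0.

Lemma ends_at_combine (F G : nat -> C) (a b : C) m :
  ends_at F m -> (forall n, (m <= n)%N -> G n = 0) -> a != 0 ->
  ends_at (fun n => a * F n + b * G n) m.
Proof.
move=> [F0 Fm] G0 a0; split=> [n ltmn|].
  by rewrite F0 // G0 ?mulr0 ?addr0 // ltnW.
by rewrite G0 // mulr0 addr0 mulf_neq0.
Qed.

Lemma two_orthogonal_wrtP (u0 u1 : {scalar {poly C}}) P :
  two_orthogonal_wrt u0 u1 P <->
  (forall j, ends_at (fun n => u0 ('X^j * P n)) (2 * j)) /\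
  (forall j, ends_at (fun n => u1 ('X^j * P n)) (2 * j).+1).
Proof.
split=> [orP | [end_u0 end_u1] j n].
  split=> j; split=> [n lt|].
  - by have [+ _ _ _] := orP j n; apply; lia.
  - by have [_ + _ _] := orP j (2 * j)%N; apply.
  - by have [_ _ + _] := orP j n; apply; lia.
  - by have [_ _ _] := orP j (2 * j).+1; apply; lia.
have [z0 n0] := end_u0 j; have [z1 n1] := end_u1 j; split=> [lt|->|lt|->] //.
- by apply: z0; lia.
- by apply: z1; lia.
- by rewrite addn1.
Qed.

(** The common source of the two-orthogonality of a component and of its
derivatives. [F0] and [F1] are families of pairings with the indices of a
two-orthogonal sequence, and the pairings of [Q] with the shifted functionals
[L0 e], [L1 e] are, up to nonzero factors, the terms of index [3 * n + k]. The
roles of the two functionals are exchanged when [k] is odd, since [3 * m + k]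
then has the parity opposite to that of [m]. *)
Lemma two_orthogonal_thinning (k : 'I_3) Q (F0 F1 : nat -> nat -> C)
    (c : nat -> C) (L0 L1 : nat -> {scalar {poly C}}) :
  polynomial_sequence Q ->
  (forall j, ends_at (F0 j) (2 * j)) -> (forall j, ends_at (F1 j) (2 * j).+1) ->
  (forall n, c n != 0) ->
  (forall e j n, L0 e ('X^j * Q n) = c n * F0 (e + 3 * j)%N (3 * n + k)%N) ->
  (forall e j n, L1 e ('X^j * Q n) = c n * F1 (e + 3 * j)%N (3 * n + k)%N) ->
  two_orthogonal Q.
Proof.
move=> psQ F0P F1P c0 L0E L1E; split=> //.
have thin (F : nat -> C) (L : nat -> C) m m' : ends_at F m' ->
    (forall n, L n = c n * F (3 * n + k)%N) -> m' = (3 * m + k)%N ->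
    ends_at L m.
  move=> [Fz Fn] LE def_m'; split=> [n lt|]; rewrite LE.
    by rewrite Fz ?mulr0 //; lia.
  by rewrite -def_m' mulf_neq0.
have thin0 e j m : (2 * (e + 3 * j) = 3 * m + k)%N ->
    ends_at (fun n => L0 e ('X^j * Q n)) m.
  by apply: thin (F0P _) (L0E e j).
have thin1 e j m : ((2 * (e + 3 * j)).+1 = 3 * m + k)%N ->
    ends_at (fun n => L1 e ('X^j * Q n)) m.
  by apply: thin (F1P _) (L1E e j).
case: k L0E L1E thin thin0 thin1 => [] [|[|[|//]]] /= _ _ _ _ thin0 thin1.
(* The shift [e] solves 2e = k or 2e + 1 = k for the first functional and
   2e = 3 + k or 2e + 1 = 3 + k for the second, whichever parity allows. *)
- exists (L0 0), (L1 1); apply/two_orthogonal_wrtP; split=> j.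
    by apply: thin0; lia.
  by apply: thin1; lia.
- exists (L1 0), (L0 2); apply/two_orthogonal_wrtP; split=> j.
    by apply: thin1; lia.
  by apply: thin0; lia.
- exists (L0 1), (L1 2); apply/two_orthogonal_wrtP; split=> j.
    by apply: thin0; lia.
  by apply: thin1; lia.
Qed.

(** Orthogonality puts no constraint on [u1 1], so a multiple of [u0] may be
subtracted from [u1]. Without this normalisation [u1] need not respect the
grading. *)
Lemma two_orthogonal_normalised P : two_orthogonal P ->
  exists u0 u1 : {scalar {poly C}}, two_orthogonal_wrt u0 u1 P /\ u1 1 = 0.
Proof.
move=> [psP [u0 [u1 orP]]].
have u01 : u0 1 != 0.
  by have [_ /(_ erefl)] := orP 0 0; rewrite (P0_eq1 psP) expr0 mulr1.
have /scalar_functional[v vE] : scalar (fun f => u1 f - u1 1 / u0 1 * u0 f).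
  by move=> a f g; rewrite !linearP /=; ring.
exists u0, v; split; last by rewrite vE divfK ?subrr.
move=> k n; have [u0k u0k_neq0 u1k u1k_neq0] := orP k n; split=> // [le|eqn].
  by rewrite vE u0k ?u1k ?mulr0 ?subr0 //; lia.
by rewrite vE u0k ?mulr0 ?subr0 ?u1k_neq0 //; lia.
Qed.

Lemma cubic_comp_shift P (k : 'I_3) Q (e j n : nat) :
  cubic_component P k Q ->
  'X^(k + e) * (('X^j * Q n) \Po 'X^3) = 'X^(e + 3 * j) * P (3 * n + k)%N.
Proof.
move=> ->; rewrite comp_polyM comp_Xn_poly -exprM !exprD; ring.
Qed.

Lemma two_orthogonal_component P (k : 'I_3) Q :
  two_orthogonal P -> cubic_component P k Q -> two_orthogonal Q.
Proof.
move=> [psP [u0 [u1 /two_orthogonal_wrtP[end_u0 end_u1]]]] PQ.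
have psQ := polynomial_sequence_component psP PQ.
pose pullback (u : {scalar {poly C}}) e : {scalar {poly C}} :=
  u \o ('X^(k + e) \*o comp_poly 'X^3).
have pullbackE u e j n :
    pullback u e ('X^j * Q n) = 1 * u ('X^(e + 3 * j) * P (3 * n + k)%N).
  by rewrite mul1r /= (cubic_comp_shift _ _ _ PQ).
exact: (two_orthogonal_thinning psQ end_u0 end_u1 (fun=> oner_neq0 _)
         (pullbackE u0) (pullbackE u1)).
Qed.

Lemma functional_graded P (u0 u1 : {scalar {poly C}}) :
  polynomial_sequence P -> (forall n, graded n (P n)) ->
  two_orthogonal_wrt u0 u1 P -> u1 1 = 0 ->
  (forall n p, graded n p -> n != 0 %[mod 3] -> u0 p = 0) /\
  (forall n p, graded n p -> n != 1 %[mod 3] -> u1 p = 0).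
Proof.
move=> psP grP /two_orthogonal_wrtP[/(_ 0)[end_u0 _] /(_ 0)[end_u1 _]] u11.
split; apply: (graded_functional0 psP grP) => -[|n] // n0.
- by have := end_u0 n.+1; rewrite expr0 mul1r; apply.
- by rewrite (P0_eq1 psP).
- by have := end_u1 n.+1; rewrite expr0 mul1r; apply; case: n n0.
Qed.

(** * Twisted derivatives *)

(** This is X^(s+1) (X^(t-s) p)', written so that it remains a polynomial
expression when [t < s]. For [s = k + t] the function differentiated is
p / X^k, which is a polynomial in X^3 when [p] is a member of the [k]-th
component. *)
Definition twisted_derivative (s t : nat) (p : {poly C}) : {poly C} :=
  ('X^(t.+1) * p)^`() - (s.+1%:R : C) *: ('X^t * p).

Lemma twisted_derivative_diag t p :
  twisted_derivative t t p = 'X^(t.+1) * p^`().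
Proof.
by rewrite /twisted_derivative derivM derivXn scaler_nat /= mulrnAl addrC addKr.
Qed.

Lemma twisted_derivative_component t k (q : {poly C}) :
  twisted_derivative (k + t) t ('X^k * (q \Po 'X^3)) =
  (3%:R : C) *: ('X^((k + t).+3) * (q^`() \Po 'X^3)).
Proof.
rewrite /twisted_derivative !mulrA -!exprD.
have -> : (t.+1 + k = (k + t).+1)%N by lia.
have -> : (t + k = k + t)%N by lia.
rewrite derivM derivXn deriv_comp derivXn !scaler_nat /= mulrnAl addrC addKr.
by rewrite !exprS -mulr_natr; ring.
Qed.

(** * Pearson equations of a threefold symmetric Hahn-classical sequence *)

Lemma derivatives_ends_at P (v : {scalar {poly C}}) j m :
  ends_at (fun n => v ('X^j * monic_derivatives P n)) m ->
  ends_at (fun n => v ('X^j * (P n)^`())) m.+1.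
Proof.
move=> [Q0 Qm]; split=> [[//|n] lt|];
  rewrite derivS_monic_derivatives -scalerAr linearZ /=.
  by rewrite Q0 ?mulr0.
by rewrite mulf_neq0 ?pnatr_eq0.
Qed.

Section PearsonEquations.

Variables (P : nat -> {poly C}) (u0 u1 v0 v1 : {scalar {poly C}}).
Hypothesis psP : polynomial_sequence P.
Hypothesis grP : forall n, graded n (P n).
Arguments grP : clear implicits.
Hypothesis orP : two_orthogonal_wrt u0 u1 P.
Hypothesis orQ : two_orthogonal_wrt v0 v1 (monic_derivatives P).
Hypothesis u11 : u1 1 = 0.
Hypothesis v11 : v1 1 = 0.

Let psQ := polynomial_sequence_derivatives psP.

Let grQ n : graded n (monic_derivatives P n).
Proof.
move=> i; rewrite coefZ mulf_eq0 negb_or => /andP[_].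
exact: (graded_deriv (grP n.+1)).
Qed.

Arguments grQ : clear implicits.

Let end_u0 j : ends_at (fun n => u0 ('X^j * P n)) (2 * j).
Proof. by have /two_orthogonal_wrtP[] := orP. Qed.
Let end_u1 j : ends_at (fun n => u1 ('X^j * P n)) (2 * j).+1.
Proof. by have /two_orthogonal_wrtP[] := orP. Qed.
Let end_v0 j : ends_at (fun n => v0 ('X^j * (P n)^`())) (2 * j).+1.
Proof.
by have /two_orthogonal_wrtP[+ _] := orQ => /(_ j) /derivatives_ends_at.
Qed.
Let end_v1 j : ends_at (fun n => v1 ('X^j * (P n)^`())) (2 * j).+2.
Proof.
by have /two_orthogonal_wrtP[_] := orQ => /(_ j) /derivatives_ends_at.
Qed.

Let u0_graded j n : j + n != 0 %[mod 3] -> u0 ('X^j * P n) = 0.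
Proof.
by apply: (functional_graded psP grP orP u11).1; apply: graded_mulXn.
Qed.
Let u1_graded j n : j + n != 1 %[mod 3] -> u1 ('X^j * P n) = 0.
Proof.
by apply: (functional_graded psP grP orP u11).2; apply: graded_mulXn.
Qed.
Let v0_graded n : n != 0 %[mod 3] -> v0 (P n) = 0.
Proof. exact: (functional_graded psQ grQ orQ v11).1. Qed.
Let v1_graded n : n != 1 %[mod 3] -> v1 (P n) = 0.
Proof. exact: (functional_graded psQ grQ orQ v11).2. Qed.

Let scalar_mulXn (u : {scalar {poly C}}) j a p q :
  u ('X^j * (a *: p + q)) = a * u ('X^j * p) + u ('X^j * q).
Proof. by rewrite mulrDr -scalerAr linearP. Qed.

Let derivP0 : (P 0)^`() = 0.
Proof. by rewrite (P0_eq1 psP) derivC. Qed.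

Let mul1X (p : {poly C}) : p = 'X^0 * p. Proof. by rewrite mul1r. Qed.

Let u0_P n : (0 < n)%N -> u0 (P n) = 0.
Proof. by rewrite [P n]mul1X; apply: (end_u0 0).1. Qed.
Let u1_P n : (1 < n)%N -> u1 (P n) = 0.
Proof. by rewrite [P n]mul1X; apply: (end_u1 0).1. Qed.

Let deriv_mulX (p : {poly C}) : ('X^1 * p)^`() = p + 'X^1 * p^`().
Proof. by rewrite derivM derivX mul1r. Qed.

(** Both sides vanish at [P n] for all [n] but 1: the left one because
[(P n)^`()] is a multiple of an element of the orthogonal sequence of
derivatives. *)
Lemma pearson_v0_deriv : exists l, forall p, v0 p^`() = l * u1 p.
Proof.
exists (v0 (P 1)^`() / u1 (P 1)).
apply: (functional_eq psP) => [a p q|a p q|n].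
- by rewrite derivD derivZ linearP.
- by rewrite linearP /=; ring.
case: n => [|[|n]].
- by rewrite derivP0 linear0 (P0_eq1 psP) u11 mulr0.
- by rewrite divfK // (mul1X (P 1)); have [] := end_u1 0.
by rewrite [_^`()]mul1X (end_v0 0).1 // (@u1_P n.+2) ?mulr0.
Qed.

(** Here [n = 2] is the only index at which both sides may be nonzero; for
[n <= 1], where orthogonality says nothing of [u0 ('X^1 * P n)], the grading
does. *)
Lemma pearson_v1_deriv : exists h, forall p, v1 p^`() = h * u0 ('X^1 * p).
Proof.
exists (v1 (P 2)^`() / u0 ('X^1 * P 2)).
apply: (functional_eq psP) => [a p q|a p q|n].
- by rewrite derivD derivZ linearP.
- by rewrite scalar_mulXn; ring.
case: n => [|[|[|n]]].
- by rewrite derivP0 linear0 (@u0_graded 1 0) ?mulr0.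
- rewrite derivS_monic_derivatives scale1r (P0_eq1 psQ) v11.
  by rewrite (@u0_graded 1 1) ?mulr0.
- by rewrite divfK //; have [] := end_u0 1.
by rewrite [_^`()]mul1X (end_v1 0).1 // ((end_u0 1).1 n.+3) ?mulr0.
Qed.

(** The grading leaves the indices 0 and 3, which fix [a] and [b], and larger
ones, where [v0 (P n)] vanishes since [P n] is [('X * P n)^`()] minus
['X * (P n)^`()] and [v0] kills both. *)
Lemma pearson_v0 :
  exists a b, forall p, v0 p = a * u0 p + b * u1 ('X^1 * p).
Proof.
have [l v0D] := pearson_v0_deriv.
have u00 : u0 (P 0) != 0 by rewrite (mul1X (P 0)); have [] := end_u0 0.
pose b := v0 (P 3) / u1 ('X^1 * P 3).
pose a := (v0 (P 0) - b * u1 ('X^1 * P 0)) / u0 (P 0).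
exists a, b.
apply: (functional_eq psP) => [e p q|e p q|n].
- by rewrite linearP.
- by rewrite scalar_mulXn linearP /=; ring.
case: n => [|[|[|[|n]]]].
- by rewrite divfK // subrK.
- by rewrite v0_graded // u1_graded // u0_P // !mulr0 addr0.
- by rewrite v0_graded // u1_graded // u0_P // !mulr0 addr0.
- rewrite divfK; last by have [] := end_u1 1.
  by rewrite u0_P // mulr0 add0r.
have -> : P n.+4 = ('X^1 * P n.+4)^`() - 'X^1 * (P n.+4)^`().
  by rewrite deriv_mulX addrK.
rewrite linearB /= v0D (end_v0 1).1 // !deriv_mulX addrK.
by rewrite u0_P // (end_u1 1).1 // !mulr0 subr0 addr0.
Qed.

(** As for [v0], with the indices 1 and 4 fixing the coefficients. *)
Lemma pearson_v1 :
  exists c d, forall p, v1 p = c * u1 p + d * u0 ('X^2 * p).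
Proof.
have [h v1D] := pearson_v1_deriv.
have u1P1 : u1 (P 1) != 0 by rewrite (mul1X (P 1)); have [] := end_u1 0.
pose d := v1 (P 4) / u0 ('X^2 * P 4).
pose c := (v1 (P 1) - d * u0 ('X^2 * P 1)) / u1 (P 1).
exists c, d.
apply: (functional_eq psP) => [e p q|e p q|n].
- by rewrite linearP.
- by rewrite scalar_mulXn linearP /=; ring.
case: n => [|[|[|[|[|n]]]]].
- by rewrite v1_graded // u0_graded // [P 0]mul1X u1_graded // !mulr0 addr0.
- by rewrite divfK // subrK.
- by rewrite v1_graded // (@u0_graded 2 2) // u1_P // !mulr0 addr0.
- by rewrite v1_graded // (@u0_graded 2 3) // u1_P // !mulr0 addr0.
- rewrite divfK; last by have [] := end_u0 2.
  by rewrite u1_P // mulr0 add0r.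
have -> : P n.+4.+1 = ('X^1 * P n.+4.+1)^`() - 'X^1 * (P n.+4.+1)^`().
  by rewrite deriv_mulX addrK.
rewrite linearB /= v1D (end_v1 1).1 // !deriv_mulX addrK mulrA -exprD.
by rewrite u1_P // (end_u0 2).1 // !mulr0 subr0 addr0.
Qed.

(** * Components of a Hahn-classical sequence *)

(** The Pearson equations express the pairing through the orthogonality of [P]
alone, up to the factor [l - s.+1%:R * b], which depends only on [s]. Taking
[t = s] shows that it is nonzero. *)
Lemma twisted_v0_ends_at s t :
  ends_at (fun n => v0 (twisted_derivative s t (P n))) (2 * t).+3.
Proof.
have [l v0D] := pearson_v0_deriv; have [a [b v0E]] := pearson_v0.
have twE s1 t1 n : v0 (twisted_derivative s1 t1 (P n)) =
    (l - s1.+1%:R * b) * u1 ('X^(t1.+1) * P n)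
    + (- (s1.+1%:R * a)) * u0 ('X^t1 * P n).
  by rewrite linearB linearZ /= v0D v0E mulrA -exprD; ring.
have u1S t1 : ends_at (fun n => u1 ('X^(t1.+1) * P n)) (2 * t1).+3.
  by have := end_u1 t1.+1; rewrite mulnS.
have u0z t1 n : ((2 * t1).+3 <= n)%N -> u0 ('X^t1 * P n) = 0.
  by move=> lt; apply: (end_u0 t1).1; lia.
have lsb : l - s.+1%:R * b != 0.
  have := (end_v0 s.+1).2; rewrite -twisted_derivative_diag twE u0z;
    last by lia.
  by rewrite mulr0 addr0 mulf_eq0 negb_or => /andP[].
have [z nz] := ends_at_combine (- (s.+1%:R * a)) (u1S t) (u0z t) lsb.
by split=> [n lt|]; rewrite twE // z.
Qed.

Lemma twisted_v1_ends_at s t :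
  ends_at (fun n => v1 (twisted_derivative s t (P n))) (2 * t).+4.
Proof.
have [h v1D] := pearson_v1_deriv; have [c [d v1E]] := pearson_v1.
have twE s1 t1 n : v1 (twisted_derivative s1 t1 (P n)) =
    (h - s1.+1%:R * d) * u0 ('X^(t1.+2) * P n)
    + (- (s1.+1%:R * c)) * u1 ('X^t1 * P n).
  by rewrite linearB linearZ /= v1D v1E !mulrA -!exprD; ring.
have u0S t1 : ends_at (fun n => u0 ('X^(t1.+2) * P n)) (2 * t1).+4.
  by have := end_u0 t1.+2; rewrite !mulnS.
have u1z t1 n : ((2 * t1).+4 <= n)%N -> u1 ('X^t1 * P n) = 0.
  by move=> lt; apply: (end_u1 t1).1; lia.
have hsd : h - s.+1%:R * d != 0.
  have := (end_v1 s.+1).2; rewrite -twisted_derivative_diag twE u1z;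
    last by lia.
  by rewrite mulr0 addr0 mulf_eq0 negb_or => /andP[].
have [z nz] := ends_at_combine (- (s.+1%:R * c)) (u0S t) (u1z t) hsd.
by split=> [n lt|]; rewrite twE // z.
Qed.

End PearsonEquations.

Lemma Hahn_classical_component P (k : 'I_3) Q :
  Hahn_classical P -> (forall n, graded n (P n)) -> cubic_component P k Q ->
  Hahn_classical Q.
Proof.
move=> [orP orQ] grP PQ; have psP := orP.1.
have orPk := two_orthogonal_component orP PQ; split=> //.
have psDQ := polynomial_sequence_derivatives orPk.1.
have [u0 [u1 [orP' u11]]] := two_orthogonal_normalised orP.
have [v0 [v1 [orQ' v11]]] := two_orthogonal_normalised orQ.
pose F (v : {scalar {poly C}}) t n :=
  v (twisted_derivative (k + t) t (P n.+3)).
have F0 t : ends_at (F v0 t) (2 * t).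
  have [z nz] := twisted_v0_ends_at psP grP orP' orQ' u11 v11 (k + t) t.
  by split=> [n lt|//]; apply: z.
have F1 t : ends_at (F v1 t) (2 * t).+1.
  have [z nz] := twisted_v1_ends_at psP grP orP' orQ' u11 v11 (k + t) t.
  by split=> [n lt|//]; apply: z.
pose pullback (v : {scalar {poly C}}) e : {scalar {poly C}} :=
  v \o ('X^((k + e).+3) \*o comp_poly 'X^3).
pose c n : C := (n.+1%:R * 3%:R)^-1.
have c_neq0 n : c n != 0 by rewrite invr_eq0 mulf_neq0 // pnatr_eq0.
have pullbackE v e j n : pullback v e ('X^j * monic_derivatives Q n) =
    c n * F v (e + 3 * j)%N (3 * n + k)%N.
  rewrite /F; have -> : (3 * n + k).+3 = (3 * n.+1 + k)%N by lia.
  rewrite PQ twisted_derivative_component linearZ /= /c invfM mulrA.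
  rewrite mulfVK ?pnatr_eq0 //.
  rewrite -scalerAr comp_polyZ -scalerAr linearZ /= comp_polyM comp_Xn_poly.
  by rewrite -exprM mulrA -exprD addnA.
exact: (two_orthogonal_thinning psDQ F0 F1 c_neq0
         (pullbackE v0) (pullbackE v1)).
Qed.

End CubicComponents.

Theorem theorem4p1 (R : realType) (P : nat -> {poly R[i]})
    (hH : Hahn_classical P) (hS : threefold_symmetric P)
    (k : 'I_3) (Pk : nat -> {poly R[i]}) (hPk : cubic_component P k Pk) :
  Hahn_classical Pk.
Proof.
exact: (Hahn_classical_component hH (threefold_symmetric_coef hS) hPk).
Qed.
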